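(* Let $\sigma:\mathbb{Z}_+\to\mathcal{P}$ be the switching signal applied to the discrete switched system $x[k+1]=P_{\sigma(k)}(x[k])$ defined in the context. If $x[0]\in\mathcal{S}\cap\mathcal{Z}$, then for any $k\in\mathbb{Z}_+$, $$\varphi_{\sigma(k+1)}(t,\Delta(x[k]))\in\mathcal{Z}_{\sigma(k+1)}\quad\text{for all }t\in[t_k,\,T_I(x[k],\beta_{\sigma(k+1)})).$$
   Context: $\mathbb{Z}_+=\{0,1,2,\dots\}$. Model. A planar five-link biped with one degree of underactuation has configuration $q=(q_1,\dots,q_5)\in Q\subset\mathbb{R}^5$ and state $x=(q,\dot q)\in TQ=\{(q,\dot q): q\in Q,\ \dot q\in\mathbb{R}^5\}$. The swing-phase dynamics $D(q)\ddot q+C(q,\dot q)\dot q+G(q)=Bu$ ($u\in\mathbb{R}^4$) is written $\dot x=f(x)+g(x)u$. With $p_{\rm v}(q)$ the swing-foot height, $\mathcal{S}=\{(q,\dot q)\in TQ: p_{\rm v}(q)=0,\ \dot p_{\rm v}(q,\dot q)<0\}$, and $\Delta:\mathcal{S}\to TQ$ is the impact map. Outputs. Let $q_{\rm a}=(q_2,q_3,q_4,q_5)$ and $\theta(q)=q_1+q_2+\frac12 q_4$; $\theta$ increases monotonically during a step, from $\theta^+$ (post-impact, beginning of the step) to $\theta^-$ (pre-impact, end of the step). The nominal output is $h(q)=q_{\rm a}-h_{\rm d}(\theta(q))$ and, for $\beta\in\mathbb{R}^{\dim(\beta)}$, $h_\beta(q)=h(q)-h_{\rm s}(\theta(q),\beta)$,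 where $h_{\rm s}(\theta,\beta)$ is a (piecewise) polynomial in $\theta$ with coefficients depending on $\beta$ such that $h_{\rm s}(\theta,0)=0$ for $\theta^+\le\theta\le\theta^-$ and, with $\theta_{\rm s}=\theta^++0.9(\theta^--\theta^+)$, for all $\beta$: $h_{\rm s}(\theta^+,\beta)=0$, $\frac{\partial h_{\rm s}}{\partial\theta}(\theta^+,\beta)=0$; $h_{\rm s}(\theta_{\rm s},\beta)=0$, $\frac{\partial^i h_{\rm s}}{\partial\theta^i}(\theta_{\rm s},\beta)=0$, $i=1,2$; $h_{\rm s}(\theta,\beta)=0$ for $\theta_{\rm s}\le\theta\le\theta^-$. Set $\mathcal{Z}=\{(q,\dot q)\in TQ:h(q)=0,\ L_fh(q,\dot q)=0\}$ and $\mathcal{Z}_\beta=\{(q,\dot q)\in TQ:h_\beta(q)=0,\ L_fh_\beta(q,\dot q)=0\}$, considered for $\theta(q)\in[\theta^+,\theta^-]$. The function $h_{\rm d}$ is designed so that $\mathcal{Z}$ is impact invariant, $\Delta(\mathcal{S}\cap\mathcal{Z})\subset\mathcal{Z}$, with post-impact states satisfying $\theta=\theta^+$. Foot impact occurs at the end of a step, i.e. points of $\mathcal{S}\cap\mathcal{Z}$ and $\mathcal{S}\cap\mathcal{Z}_\beta$ have $\theta(q)\in[\theta_{\rm s},\theta^-]$. The control law is $u_\beta^*(x)=-\big(L_gL_fh_\beta(x)\big)^{-1}L_f^2h_\beta(x)$ (decoupling matrix invertible where used), which renders $\mathcal{Z}_\beta$ invariant under $\dot x=f(x)+g(x)u_\beta^*(x)$.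 Switched system. $\mathbb{B}=\{\beta_p:p\in\mathcal{P}\}$ is a finite set of parameters, each corresponding to an exponentially stable limit cycle; a subscript $p$ abbreviates $\beta_p$ (so $\mathcal{Z}_p=\mathcal{Z}_{\beta_p}$, $\varphi_p=\varphi_{\beta_p}$). $\varphi_\beta(t,x)$ is the maximal solution of $\dot x=f(x)+g(x)u_\beta^*(x)$ starting at $x$ at the starting time $t_k$ of the $k$-th step; $T_I(x,\beta)=\inf\{t\ge t_k:\varphi_\beta(t,\Delta(x))\in\mathcal{S}\}$; $P_p(x)=\varphi_{\beta_p}(T_I(x,\beta_p),\Delta(x))$ is the Poincaré map $\mathcal{S}\to\mathcal{S}$. There are no external disturbances, and the solution $x[k]$ of the switched system is understood to be defined. *)

(* Defs.v *)
From HB Require Import structures.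
From mathcomp Require Import all_boot all_order all_algebra.
From mathcomp Require Import all_classical all_reals all_analysis.

Set Implicit Arguments.
Unset Strict Implicit.
Unset Printing Implicit Defensive.

Import Order.TTheory GRing.Theory Num.Theory.
Import numFieldNormedType.Exports.

Local Open Scope classical_set_scope.
Local Open Scope ring_scope.

(* x = (q, qdot) *)
Notation state R := ('cV[R]_5 * 'cV[R]_5)%type.

(* Time derivative of [y] along a motion with velocity [v] at [x];
   for a vector field [F], the Lie derivative L_F y is [lie F y]. *)
Definition lie (R : realType) (W : normedModType R)
  (F : state R -> state R) (y : state R -> W) (x : state R) : W :=
  'D_(F x) y x.

Section Biped.
Variable R : realType.

(* The data of the equation of motion are total functions; only their values
   on the configuration space are constrained. *)
Record biped := Biped {
  conf : set 'cV[R]_5;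
  inertia : 'cV[R]_5 -> 'M[R]_5;
  coriolis : 'cV[R]_5 -> 'cV[R]_5 -> 'M[R]_5;
  gravity : 'cV[R]_5 -> 'cV[R]_5;
  actuation : 'M[R]_(5, 4);
  foot_height : 'cV[R]_5 -> R;
  impact : state R -> state R;
  inertia_unit : forall q, conf q -> inertia q \in unitmx;
  foot_height_diff : forall q, conf q -> differentiable foot_height q;
  impact_conf : forall x : state R, conf x.1 -> foot_height x.1 = 0 ->
    'D_(x.2) foot_height x.1 < 0 -> conf (impact x).1 }.

Variable M : biped.

Definition TQ : set (state R) := [set x | conf M x.1].

Definition surfS : set (state R) :=
  [set x | [/\ TQ x, foot_height M x.1 = 0
             & 'D_(x.2) (foot_height M) x.1 < 0]].

Definition drift (x : state R) : state R :=
  (x.2, invmx (inertia M x.1) *m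
          (- (coriolis M x.1 x.2 *m x.2) - gravity M x.1)).

(* g_j, the j-th column of g *)
Definition ctrl (j : 'I_4) (x : state R) : state R :=
  (0, col j (invmx (inertia M x.1) *m actuation M)).

Definition theta (q : 'cV[R]_5) : R :=
  q (inord 0) 0 + q (inord 1) 0 + 2^-1 * q (inord 3) 0.

Definition q_act (q : 'cV[R]_5) : 'cV[R]_4 := \col_(i < 4) q (lift ord0 i) 0.

Definition piecewise_poly (a b : R) (F : R -> 'cV[R]_4) : Prop :=
  exists (n : nat) (tau : nat -> R) (pl : nat -> 'I_4 -> {poly R}),
    [/\ tau 0%N = a, tau n = b,
        forall i, (i < n)%N -> tau i <= tau i.+1
      & forall i, (i < n)%N -> forall s, tau i <= s <= tau i.+1 ->
          forall j, F s j 0 = (pl i j).[s]].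

Definition twice_derivable_at (F : R -> 'cV[R]_4) (s : R) : Prop :=
  (\forall r \near s, derivable F r 1) /\ derivable (derive1 F) s 1.

Definition theta_switch (a b : R) : R := a + 9 / 10 * (b - a).

(* Twice differentiability on [theta^+, theta^-] (two-sided at the end points)
   is what makes the second Lie derivatives of the outputs meaningful. *)
Record outputs (m : nat) := Outputs {
  thp : R;
  thm : R;
  hd : R -> 'cV[R]_4;
  hs : R -> 'cV[R]_m -> 'cV[R]_4;
  thp_lt_thm : thp < thm;
  hd_smooth : forall s, thp <= s <= thm -> twice_derivable_at hd s;
  hs_smooth : forall b s, thp <= s <= thm -> twice_derivable_at (hs ^~ b) s;
  hs_poly : forall b, piecewise_poly thp thm (hs ^~ b);
  hs_0 : forall s, thp <= s <= thm -> hs s 0 = 0;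
  hs_thp : forall b, hs thp b = 0;
  hs_thp1 : forall b, derive1 (hs ^~ b) thp = 0;
  hs_ths : forall b, hs (theta_switch thp thm) b = 0;
  hs_ths1 : forall b, derive1 (hs ^~ b) (theta_switch thp thm) = 0;
  hs_ths2 : forall b, derive1n 2 (hs ^~ b) (theta_switch thp thm) = 0;
  hs_end : forall b s, theta_switch thp thm <= s <= thm -> hs s b = 0 }.

Variables (m : nat) (O : outputs m).

Definition ths : R := theta_switch (thp O) (thm O).

Definition h_nom (x : state R) : 'cV[R]_4 := q_act x.1 - hd O (theta x.1).

Definition h_par (b : 'cV[R]_m) (x : state R) : 'cV[R]_4 :=
  h_nom x - hs O (theta x.1) b.

Definition zero_surf (y : state R -> 'cV[R]_4) : set (state R) :=
  [set x | [/\ TQ x, y x = 0, lie drift y x = 0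
             & thp O <= theta x.1 <= thm O]].

Definition surfZ : set (state R) := zero_surf h_nom.

Definition surfZb (b : 'cV[R]_m) : set (state R) := zero_surf (h_par b).

(* L_g L_f h_beta *)
Definition decoupling (b : 'cV[R]_m) (x : state R) : 'M[R]_4 :=
  \matrix_(i, j) lie (ctrl j) (lie drift (h_par b)) x i 0.

Definition feedback (b : 'cV[R]_m) (x : state R) : 'cV[R]_4 :=
  - (invmx (decoupling b x) *m lie drift (lie drift (h_par b)) x).

(* [invmx] is total; the feedback is defined only on [closed_dom]. *)
Definition closed_dom (b : 'cV[R]_m) : set (state R) :=
  [set x | TQ x /\ decoupling b x \in unitmx].

Definition closed_loop (b : 'cV[R]_m) (x : state R) : state R :=
  drift x + \sum_(j < 4) feedback b x j 0 *: ctrl j x.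

(* Forward solution on the interval [J] of x' = F(x), with F defined on [X]:
   continuous on [J], satisfying the equation in the interior of [J].
   [J = [set t0]] is allowed, so that maximal solutions exist for all
   initial conditions in [X]. *)
Definition is_solution (X : set (state R)) (F : state R -> state R)
  (t0 : R) (x0 : state R) (J : set R) (xi : R -> state R) : Prop :=
  [/\ is_interval J /\ J t0,
      forall t, J t -> t0 <= t /\ X (xi t),
      xi t0 = x0,
      {within J, continuous xi}
    & forall t, J^° t -> is_derive t 1 xi (F (xi t))].

Definition is_maximal_solution (X : set (state R)) (F : state R -> state R)
  (t0 : R) (x0 : state R) (J : set R) (xi : R -> state R) : Prop :=
  is_solution X F t0 x0 J xi /\
  forall J' xi', is_solution X F t0 x0 J' xi' -> J `<=` J' ->
    (forall t, J t -> xi' t = xi t) -> J' = J.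

(* [phi b t0 x] is the maximal solution started from [x] at time [t0],
   meaningful on [phi_dom b t0 x].  No Lipschitz condition is imposed:
   where maximal solutions are not unique this is an arbitrary selection. *)
Record flow := Flow {
  phi : 'cV[R]_m -> R -> state R -> R -> state R;
  phi_dom : 'cV[R]_m -> R -> state R -> set R;
  phi_max : forall b t0 x, closed_dom b x ->
    is_maximal_solution (closed_dom b) (closed_loop b) t0 x
      (phi_dom b t0 x) (phi b t0 x) }.

Variable Phi : flow.

(* +oo when the switching surface is never reached *)
Definition impact_time (t0 : R) (x : state R) (b : 'cV[R]_m) : \bar R :=
  ereal_inf (EFin @` [set t | [/\ t0 <= t, phi_dom Phi b t0 (impact M x) t
                                & surfS (phi Phi b t0 (impact M x) t)]]).

(* Graph of the partial map P_beta : S -> S, the step starting at time [t0] *)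
Definition poincare (b : 'cV[R]_m) (t0 : R) (x y : state R) : Prop :=
  [/\ surfS x, closed_dom b (impact M x), surfS y
    & exists t, [/\ impact_time t0 x b = t%:E,
                    phi_dom Phi b t0 (impact M x) t
                  & y = phi Phi b t0 (impact M x) t]].

(* The feedback carries no term stabilizing the outputs, hence stability is
   that of the Poincare map restricted to the zero dynamics. *)
Definition exp_stable_limit_cycle (b : 'cV[R]_m) : Prop :=
  exists2 xs, (surfS `&` surfZb b) xs /\ (forall t0, poincare b t0 xs xs) &
  exists delta N rho : R,
    [/\ 0 < delta, 0 <= rho < 1
      & forall x, (surfS `&` surfZb b) x -> `|x - xs| < delta ->
          exists y : nat -> state R,
            [/\ y 0%N = x, forall n t0, poincare b t0 (y n) (y n.+1)
              & forall n, `|y n - xs| <= N * rho ^+ n * `|x - xs|]].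

(* Along the step started from [impact M x] at time [t0] under the parameter
   [b], theta increases and ranges in [theta^+, theta^-]. *)
Definition theta_increases (b : 'cV[R]_m) (t0 : R) (x : state R) : Prop :=
  let J := [set t | phi_dom Phi b t0 (impact M x) t /\
                    (t%:E <= impact_time t0 x b)%E] in
  let th t := theta (phi Phi b t0 (impact M x) t).1 in
  (forall t, J t -> thp O <= th t <= thm O) /\
  (forall s t, J s -> J t -> s < t -> th s < th t).

End Biped.

(* Main.v *)
Require Import Defs.
From HB Require Import structures.
From mathcomp Require Import all_boot all_order all_algebra.
From mathcomp Require Import ring lra.
From mathcomp Require Import all_classical all_reals all_analysis.
Set Implicit Arguments.
Unset Strict Implicit.
Unset Printing Implicit Defensive.
Import Order.TTheory GRing.Theory Num.Theory.
Import numFieldNormedType.Exports.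
Local Open Scope classical_set_scope.
Local Open Scope ring_scope.

(** Between two impacts the closed loop cannot leave [surfZb M O b] once it is
on it, and all these surfaces agree where the steps begin and where they end.

Invariance.  The output has the form q_a - F(theta), with F = h_d + h_s(., b),
so its derivative along any vector field whose configuration part is the
velocity is the explicit rate q_a' - theta' F'(theta) (lemmas
[derive_constraint], [near_lie_drift]).  The input does not enter that
derivative but enters the derivative of the rate, through the decoupling
matrix, and the feedback is chosen to cancel the latter
([derive_closed_loop_lie]).  The rate is thus a first integral of the closed
loop; once it is zero, the output itself is one ([first_integral],
[solution_zero_dynamics]).

Beginning of a step.  After an impact on Z, theta is theta^+, where h_s and its
first derivative in theta vanish for every parameter.  The post-impact state
therefore lies in Z_b for every b ([surfZ_surfZb], [hs_flat_thp]).  The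
decoupling matrix is a derivative in a pure velocity direction, hence it only
involves the outputs at the current theta; at theta^+ it does not depend on the
parameter ([decoupling_thp]), so a state from which the loop with parameter
sigma(k) can be started is one from which the loop with parameter sigma(k+1)
can be started as well.

End of a step.  At impact theta lies in [theta_s, theta^-], where h_s vanishes
identically, so a pre-impact state on Z_b is on Z ([hs_flat_end]).  By induction
on k every x[k] is in S and on Z, and the invariance applied to the step with
parameter sigma(k+1) started from x[k] concludes. *)

(** * Differentiability and first integrals *)

Section Calculus.
Variable R : realType.

(** A matrix-valued map is the sum of its scalar entries times fixed elementary
matrices, so that differentiability can be read off the entries. *)
Lemma differentiable_mx (V : normedModType R) m n (f : V -> 'M[R]_(m.+1, n.+1))
  (a : V) :
  (forall i j, differentiable (fun v => f v i j) a) -> differentiable f a.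
Proof.
move=> df.
have -> : f =
    \sum_(i < m.+1) (fun v => \sum_(j < n.+1) f v i j *: delta_mx i j).
  by apply/funext => v; rewrite [LHS]matrix_sum_delta fct_sumE.
apply: differentiable_sum => i.
have -> : (fun v => \sum_(j < n.+1) f v i j *: delta_mx i j) =
    \sum_(j < n.+1) (fun v => f v i j *: (delta_mx i j : 'M[R]_(m.+1, n.+1))).
  by apply/funext => v; rewrite fct_sumE.
by apply: differentiable_sum => j; exact: differentiableZl.
Qed.

(** In this form the continuity of a linear map, needed for it to be its own
differential, comes from its differentiability, which is proved structurally. *)
Lemma diff_linear (V W : normedModType R) (f : V -> W) (a : V) :
  linear f -> (forall v, differentiable f v) -> is_diff a f f.
Proof.
move=> f_lin df.
pose fL : {linear V -> W} := HB.pack f (GRing.isLinear.Build _ _ _ _ _ f_lin).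
apply: DiffDef; first exact: df.
rewrite -[f]/(fL : _ -> _); apply: diff_lin => v.
exact/differentiable_continuous/df.
Qed.

Lemma is_diff_fst (V W : normedModType R) (p : V * W) :
  is_diff p (fst : V * W -> V) fst.
Proof.
have fst_lin : linear (fst : V * W -> V) by [].
pose fL : {linear (V * W)%type -> V} :=
  HB.pack (fst : V * W -> V) (GRing.isLinear.Build _ _ _ _ _ fst_lin).
have cf : continuous (fL : V * W -> V) by move=> q; exact: cvg_fst.
apply: DiffDef; first exact: (linear_differentiable _ cf).
exact: (diff_lin _ cf).
Qed.

Lemma is_diff_snd (V W : normedModType R) (p : V * W) :
  is_diff p (snd : V * W -> W) snd.
Proof.
have snd_lin : linear (snd : V * W -> W) by [].
pose fL : {linear (V * W)%type -> W} :=
  HB.pack (snd : V * W -> W) (GRing.isLinear.Build _ _ _ _ _ snd_lin).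
have cf : continuous (fL : V * W -> W) by move=> q; exact: cvg_snd.
apply: DiffDef; first exact: (linear_differentiable _ cf).
exact: (diff_lin _ cf).
Qed.

(** The differential of [g] serves as the differential of [f]: the remainder in
the first-order expansion is only constrained near the point. *)
Lemma near_eq_differentiable (V W : normedModType R) (f g : V -> W)
  (a : V) :
  (\near a, g a = f a) -> differentiable g a -> differentiable f a.
Proof.
move=> gf dg.
have fo : f \o shift a = cst (f a) + 'd g a +o_ (0 : V) id.
  apply/eqaddoP => _ /posnumP[e].
  have /eqaddoP /(_ e%:num (gt0 e)) go := diff_locally dg.
  have gf0 : \forall h \near (0 : V), g (h + a) = f (h + a).
    by move: gf; rewrite (near_shift 0)/= subr0.
  have gfa : g a = f a := nbhs_singleton gf.
  apply: filterS2 go gf0 => h.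
  by rewrite !fctE /= => + gfh; rewrite gfh gfa.
have dE : 'd f a = 'd g a :> (V -> W).
  by apply: diff_unique => //; exact: diff_continuous.
apply/diff_locallyP; rewrite dE; split=> //.
exact: diff_continuous.
Qed.

(** The two functions need not agree on any neighbourhood of the point: the
difference quotients only use the values on the line. *)
Lemma eq_derive_line (V W : normedModType R) (f g : V -> W) (a v : V) :
  (forall h : R, f (h *: v + a) = g (h *: v + a)) -> 'D_v f a = 'D_v g a.
Proof.
move=> fg; have fga : f a = g a by have := fg 0; rewrite scale0r add0r.
have quot_eq : (fun h : R => h^-1 *: ((f \o shift a) (h *: v) - f a)) =
    (fun h => h^-1 *: ((g \o shift a) (h *: v) - g a)).
  by apply/funext => h; rewrite /= fg fga.
by rewrite /derive quot_eq.
Qed.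

(** A two-sided derivative equals each one-sided one, and at every point of a
nondegenerate segment at least one side stays in the segment. *)
Lemma derive1_eq0_itv (V : normedModType R) (F : R -> V) (a b s : R) :
  a < b -> a <= s <= b -> derivable F s 1 ->
  (forall r, a <= r <= b -> F r = 0) -> derive1 F s = 0.
Proof.
move=> ab /andP[as_ sb] dF F0; rewrite /derive1.
have Fs : F s = 0 by apply: F0; rewrite as_.
have cF : cvg ((fun h : R => h^-1 *: (F (h + s) - F s)) @ 0^').
  rewrite (_ : (fun _ => _) =
    fun h : R => h^-1 *: ((F \o shift s) (h *: (1 : R)) - F s)) //.
  by apply/funext => h /=; rewrite [_%:A]mulr1.
have [sltb|bles] := ltP s b.
  rewrite (cvg_at_rightE (fun h : R => h^-1 *: (F (h + s) - F s)))//.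
  apply: lim_near_cst => //; near=> h.
  rewrite Fs F0 ?subrr ?scaler0//; apply/andP; split.
    by rewrite (le_trans as_)// lerDr.
  by rewrite -lerBrDr; near: h; apply: nbhs_right_le; rewrite subr_gt0.
rewrite (cvg_at_leftE (fun h : R => h^-1 *: (F (h + s) - F s)))//.
apply: lim_near_cst => //; near=> h.
rewrite Fs F0 ?subrr ?scaler0//; apply/andP; split; last first.
  by rewrite (le_trans _ sb)// gerDr.
rewrite -lerBlDr; near: h; apply: nbhs_left_ge; rewrite subr_lt0.
exact: lt_le_trans ab bles.
Unshelve. all: by end_near. Qed.

Lemma twice_derivable_once (F : R -> 'cV[R]_4) (s : R) :
  twice_derivable_at F s -> derivable F s 1.
Proof. by move=> [/nbhs_singleton]. Qed.

Lemma twice_derivable_atD (F G : R -> 'cV[R]_4) (s : R) :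
  twice_derivable_at F s -> twice_derivable_at G s ->
  twice_derivable_at (F + G) s.
Proof.
move=> [dF ddF] [dG ddG]; split.
  by apply: filterS2 dF dG => r dFr dGr; exact: derivableD.
apply: (@near_eq_derivable _ _ _ (derive1 F + derive1 G)).
  apply: filterS2 dF dG => r dFr dGr.
  rewrite [LHS]/(derive1 F r + derive1 G r).
  rewrite [derive1 (F + G) r]derive1E (deriveD dFr dGr).
  by rewrite (derive1E F) (derive1E G).
exact: derivableD.
Qed.

(** By the chain rule [G \o xi] has zero derivative inside the segment, and the
mean value theorem applies to each of its entries.  The equation of motion is
only required in the open segment, since solutions are merely continuous at
the ends of their interval of definition. *)
Lemma first_integral (V : normedModType R) n (J : set R) (xi : R -> V)
  (F : V -> V) (G : V -> 'cV[R]_n.+1) (a b : R) :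
  a <= b -> `[a, b] `<=` J -> {within J, continuous xi} ->
  (forall t, a < t < b -> is_derive t 1 xi (F (xi t))) ->
  (forall t, a <= t <= b -> differentiable G (xi t)) ->
  (forall t, a < t < b -> 'D_(F (xi t)) G (xi t) = 0) ->
  G (xi b) = G (xi a).
Proof.
move=> ab abJ cxi dxi dG G0.
have cGxi : {within `[a, b], continuous (G \o xi)}.
  apply/subspace_continuousP => t abt.
  apply: (@cvg_comp _ _ _ xi G _ (nbhs (xi t))).
    by have /subspace_continuousP := continuous_subspaceW abJ cxi; apply.
  apply: (@differentiable_continuous _ _ _ (xi t) G); apply: dG.
  by move: abt; rewrite /= in_itv.
have dGxi t : a < t < b -> is_derive t 1 (G \o xi) 0.
  move=> /[dup] /[dup] /andP[at_ tb] /dxi[/derivable1_diffP dxit xi'] /G0 G0t.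
  have dGt : differentiable G (xi t) by apply: dG; rewrite !ltW.
  have dc := differentiable_comp dxit dGt.
  apply: DeriveDef; first exact/derivable1_diffP.
  by rewrite deriveE// diff_comp//= -(deriveE _ dxit) xi' -deriveE.
apply/colP => i.
have dGi t : a < t < b -> is_derive t 1 (fun u => G (xi u) i 0) (0 : R).
  move=> /dGxi[d1 d2]; apply: DeriveDef.
    by move/derivable_mxP : d1; exact.
  by have := congr1 (fun N : 'cV[R]_n.+1 => N i 0) d2; rewrite derive_mx// !mxE.
have cGi : {within `[a, b], continuous (fun u => G (xi u) i 0)}.
  move=> t; apply: (@continuous_comp _ _ _ _ (fun N : 'cV[R]_n.+1 => N i 0)).
    exact: cGxi.
  exact: coord_continuous.
have dGi' t : t \in `]a, b[ -> is_derive t 1 (fun u => G (xi u) i 0) (0 : R).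
  by rewrite in_itv; exact: dGi.
have [c _] := MVT_segment ab dGi' cGi.
by rewrite mul0r => /eqP; rewrite subr_eq0 => /eqP.
Qed.

End Calculus.

(** * Outputs of the form q_a - F(theta) *)

Section Outputs.
Variables (R : realType).

Lemma theta_linear : linear (@theta R).
Proof. by move=> k p q; rewrite /theta !mxE -mulr_algl [k%:A]mulr1; ring. Qed.

Lemma q_act_linear : linear (@q_act R).
Proof. by move=> k p q; apply/colP => i; rewrite !mxE. Qed.

Lemma is_diff_theta (q : 'cV[R]_5) : is_diff q (@theta R) (@theta R).
Proof.
apply: diff_linear => [|p]; first exact: theta_linear.
apply: differentiableD; last exact/differentiableZ/differentiable_coord.
by apply: differentiableD; exact: differentiable_coord.
Qed.

Lemma is_diff_q_act (q : 'cV[R]_5) : is_diff q (@q_act R) (@q_act R).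
Proof.
apply: diff_linear => [|p]; first exact: q_act_linear.
apply: differentiable_mx => i j.
rewrite (_ : (fun _ => _) = fun v : 'cV[R]_5 => v (lift ord0 i) 0).
  exact: differentiable_coord.
by apply/funext => v; rewrite mxE.
Qed.

(** Both the nominal and the parametrized outputs are instances, for F = h_d and
F = h_d + h_s(., b) respectively. *)
Definition constraint (F : R -> 'cV[R]_4) (x : state R) : 'cV[R]_4 :=
  q_act x.1 - F (theta x.1).

(** The time derivative of the output, written without any differentiation of
the output itself, so that it can be differentiated again. *)
Definition constraint_rate (F : R -> 'cV[R]_4) (x : state R) : 'cV[R]_4 :=
  q_act x.2 - theta x.2 *: derive1 F (theta x.1).

Lemma is_diff_constraint F (x : state R) : derivable F (theta x.1) 1 ->
  is_diff x (constraint F)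
    (fun v => q_act v.1 - theta v.1 *: derive1 F (theta x.1)).
Proof.
move=> dF.
have d1 := is_diff_comp (is_diff_fst x) (is_diff_theta x.1).
have dq := is_diff_comp (is_diff_fst x) (is_diff_q_act x.1).
have dF' : is_diff (theta x.1) F ( *:%R^~ (derive1 F (theta x.1))).
  by apply: DiffDef; [exact/derivable1_diffP|exact: deriv1E].
exact: (is_diffB dq (is_diff_comp d1 dF')).
Qed.

Lemma differentiable_constraint_rate F (x : state R) :
  derivable (derive1 F) (theta x.1) 1 -> differentiable (constraint_rate F) x.
Proof.
move=> dF.
have d1 := is_diff_comp (is_diff_fst x) (is_diff_theta x.1).
have d2 := is_diff_comp (is_diff_snd x) (is_diff_theta x.2).
have dq := is_diff_comp (is_diff_snd x) (is_diff_q_act x.2).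
apply: differentiableB; first exact: ex_diff.
apply: differentiable_mx => i j.
rewrite (_ : (fun _ => _) =
  fun v : state R => theta v.2 * derive1 F (theta v.1) i j); last first.
  by apply/funext => v; rewrite mxE.
apply: differentiableM; first exact: ex_diff.
apply: (@differentiable_comp _ _ _ _ (fun v : state R => derive1 F (theta v.1))
  (fun N : 'cV[R]_4 => N i j)); last exact: differentiable_coord.
apply: (@differentiable_comp _ _ _ _ (fun v : state R => theta v.1)).
  exact: ex_diff.
exact/derivable1_diffP.
Qed.

End Outputs.

(** * Zero dynamics of the biped *)

Section Model.
Variables (R : realType) (M : biped R) (m : nat) (O : outputs R m).

Definition reference (b : 'cV[R]_m) : R -> 'cV[R]_4 := hd O + (hs O ^~ b).

Lemma h_nomE : h_nom O = constraint (hd O).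
Proof. by []. Qed.

Lemma h_parE b : h_par O b = constraint (reference b).
Proof. by apply/funext => x; rewrite /h_par /h_nom -addrA -opprD. Qed.

Lemma twice_derivable_reference b s :
  thp O <= s <= thm O -> twice_derivable_at (reference b) s.
Proof.
by move=> sO; apply: twice_derivable_atD; [exact: hd_smooth|exact: hs_smooth].
Qed.

Lemma derive1_reference b s : thp O <= s <= thm O ->
  derive1 (reference b) s = derive1 (hd O) s + derive1 (hs O ^~ b) s.
Proof.
move=> sO; rewrite !derive1E deriveD//.
- exact/twice_derivable_once/hd_smooth.
- exact/twice_derivable_once/hs_smooth.
Qed.

(** The output depends on the configuration only, so only the configuration part
of the vector field matters, and it is the velocity for the drift as for every
closed loop. *)
Lemma derive_constraint F (x v : state R) : v.1 = x.2 ->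
  derivable F (theta x.1) 1 -> 'D_v (constraint F) x = constraint_rate F x.
Proof.
move=> vx dF; have dc := is_diff_constraint dF.
by rewrite deriveE ?diff_val ?vx//; exact: ex_diff.
Qed.

(** A second Lie derivative involves the first one on a whole neighbourhood,
which is where the derivability of F around theta is used. *)
Lemma near_lie_drift F (x : state R) : twice_derivable_at F (theta x.1) ->
  \near x, lie (drift M) (constraint F) x = constraint_rate F x.
Proof.
move=> [dF _].
have ct : {for x, continuous (fun y : state R => theta y.1)}.
  apply: (@differentiable_continuous _ _ _ x (fun y : state R => theta y.1)).
  have dth := is_diff_comp (is_diff_fst x) (is_diff_theta x.1).
  exact: ex_diff.
have dFnear : \near x, derivable F (theta x.1) 1 := ct _ dF.
by apply: filterS dFnear => y; exact: derive_constraint.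
Qed.

Lemma differentiable_lie_drift F (x : state R) :
  twice_derivable_at F (theta x.1) ->
  differentiable (lie (drift M) (constraint F)) x.
Proof.
move=> dF.
apply: (near_eq_differentiable _ (differentiable_constraint_rate dF.2)).
by apply: filterS (near_lie_drift dF) => y ->.
Qed.

Lemma lie_h_par b (x : state R) : thp O <= theta x.1 <= thm O ->
  lie (drift M) (h_par O b) x = constraint_rate (reference b) x.
Proof.
move=> xO; rewrite h_parE.
apply: (derive_constraint (v := drift M x)); first by [].
exact/twice_derivable_once/twice_derivable_reference.
Qed.

Lemma lie_h_nom (x : state R) : thp O <= theta x.1 <= thm O ->
  lie (drift M) (h_nom O) x = constraint_rate (hd O) x.
Proof.
move=> xO; apply: (derive_constraint (v := drift M x)); first by [].
exact/twice_derivable_once/hd_smooth.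
Qed.

(** The two surfaces differ only by the value and the first derivative of h_s,
so they have the same points wherever both vanish: this covers the beginning as
well as the end of a step. *)
Lemma surfZ_surfZb b (x : state R) :
  (thp O <= theta x.1 <= thm O ->
    hs O (theta x.1) b = 0 /\ derive1 (hs O ^~ b) (theta x.1) = 0) ->
  surfZ M O x <-> surfZb M O b x.
Proof.
move=> hs0.
have eq0 : thp O <= theta x.1 <= thm O -> h_par O b x = h_nom O x /\
    lie (drift M) (h_par O b) x = lie (drift M) (h_nom O) x.
  move=> xO; have [h0 dh0] := hs0 xO; split.
    by rewrite /h_par h0 subr0.
  rewrite (lie_h_par b xO) (lie_h_nom xO) /constraint_rate.
  by rewrite (derive1_reference b xO) dh0 addr0.
split=> -[Tx hx lx xO]; have [eqh eql] := eq0 xO; split.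
- exact: Tx.
- rewrite eqh; exact: hx.
- rewrite eql; exact: lx.
- exact: xO.
- exact: Tx.
- rewrite -eqh; exact: hx.
- rewrite -eql; exact: lx.
- exact: xO.
Qed.

Lemma hs_flat_thp b : hs O (thp O) b = 0 /\ derive1 (hs O ^~ b) (thp O) = 0.
Proof. by split; [exact: hs_thp|exact: hs_thp1]. Qed.

Lemma theta_switch_itv : thp O <= ths O < thm O.
Proof.
have := thp_lt_thm O; rewrite /ths /theta_switch => ab.
by apply/andP; split; lra.
Qed.

Lemma hs_flat_end b s : ths O <= s <= thm O ->
  hs O s b = 0 /\ derive1 (hs O ^~ b) s = 0.
Proof.
move=> /[dup] /andP[ls sl] sO; have /andP[l1 l2] := theta_switch_itv.
split; first exact: hs_end.
apply: (derive1_eq0_itv l2 sO) => [|r]; last exact: hs_end.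
by apply/twice_derivable_once/hs_smooth; rewrite sl (le_trans l1 ls).
Qed.

(** Moving along a control direction changes the velocity and leaves theta at
theta^+; the two first Lie derivatives coincide all along such a line, so their
difference quotients are the same functions. *)
Lemma decoupling_thp b b' (x : state R) : theta x.1 = thp O ->
  decoupling M O b x = decoupling M O b' x.
Proof.
move=> xO.
have eql (y : state R) : theta y.1 = thp O ->
    lie (drift M) (h_par O b) y = lie (drift M) (h_par O b') y.
  move=> yO; have yO' : thp O <= theta y.1 <= thm O.
    by rewrite yO lexx ltW ?thp_lt_thm.
  rewrite (lie_h_par b yO') (lie_h_par b' yO') /constraint_rate.
  by rewrite (derive1_reference b yO') (derive1_reference b' yO') yO !hs_thp1.
have eqll j : lie (ctrl M j) (lie (drift M) (h_par O b)) x =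
    lie (ctrl M j) (lie (drift M) (h_par O b')) x.
  apply: (eq_derive_line (v := ctrl M j x)) => h; apply: eql.
  have -> : (h *: ctrl M j x + x).1 = x.1 by rewrite /= scaler0 add0r.
  exact: xO.
apply/matrixP => i j; rewrite [LHS]mxE [RHS]mxE.
exact: (congr1 (fun N : 'cV[R]_4 => N i 0) (eqll j)).
Qed.

Lemma closed_loop_fst b (x : state R) : (closed_loop M O b x).1 = x.2.
Proof.
rewrite /closed_loop /= (raddf_sum (fst : state R -> _)) big1 ?addr0// => j _.
by rewrite /= scaler0.
Qed.

(** The derivative is L_f^2 h + (L_g L_f h) u, and [feedback] is the solution u
that makes it zero. *)
Lemma derive_closed_loop_lie b (x : state R) : closed_dom M O b x ->
  thp O <= theta x.1 <= thm O ->
  'D_(closed_loop M O b x) (lie (drift M) (h_par O b)) x = 0.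
Proof.
move=> [_ Du] xO.
have dl : differentiable (lie (drift M) (h_par O b)) x.
  by rewrite h_parE; exact/differentiable_lie_drift/twice_derivable_reference.
rewrite (deriveE _ dl) [closed_loop _ _ _ _]/(_ + _) linearD linear_sum.
rewrite -(deriveE (drift M x) dl).
apply/eqP; rewrite addrC addr_eq0; apply/eqP.
have gain : \sum_(j < 4) feedback M O b x j 0 *:
    lie (ctrl M j) (lie (drift M) (h_par O b)) x =
    decoupling M O b x *m feedback M O b x.
  apply/colP => i; rewrite summxE [RHS]mxE; apply: eq_bigr => j _.
  by rewrite [LHS]mxE [decoupling _ _ _ _ _ _]mxE [LHS]mulrC.
transitivity (decoupling M O b x *m feedback M O b x); last first.
  by rewrite /feedback mulmxN mulmxA (mulmxV Du) mul1mx.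
rewrite -gain; apply: eq_bigr => j _.
by rewrite linearZ -(deriveE (ctrl M j x) dl).
Qed.

(** Two integrations: the first Lie derivative is conserved along the solution,
hence zero, and then the output is conserved.  Confining theta to
[theta^+, theta^-] is needed since h_d and h_s are only assumed twice derivable
there. *)
Lemma solution_zero_dynamics b (x0 : state R) (J : set R) (xi : R -> state R)
  (a s : R) :
  is_solution (closed_dom M O b) (closed_loop M O b) a x0 J xi ->
  surfZb M O b x0 -> J s ->
  (forall r, a <= r <= s -> thp O <= theta (xi r).1 <= thm O) ->
  surfZb M O b (xi s).
Proof.
move=> [[iJ Ja] Jdom xia cxi dxi] [Tx0 hx0 lx0 _] Js xiO.
have [as_ [Txis _]] := Jdom _ Js.
have asJ : `[a, s] `<=` J.
  by move=> r /=; rewrite in_itv => rs; exact: (iJ _ _ Ja Js).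
have oJ r : a < r < s -> is_derive r 1 xi (closed_loop M O b (xi r)).
  move=> rs; apply: dxi; suff : `]a, s[ `<=` J° by apply; rewrite /= in_itv.
  rewrite -open_subsetE; last exact: interval_open.
  by move=> u us; apply: asJ; exact: subset_itv_oo_cc us.
have domr r : a <= r <= s -> closed_dom M O b (xi r).
  by move=> rs; apply: (Jdom r _).2; apply: asJ; rewrite /= in_itv.
have widen r : a < r < s -> a <= r <= s by move=> /andP[? ?]; rewrite !ltW.
have lie0 r : a <= r <= s -> lie (drift M) (h_par O b) (xi r) = 0.
  move=> /andP[ar rs]; rewrite -lx0 -xia.
  have sub u : a < u < r -> a < u < s.
    by move=> /andP[-> ur]/=; exact: lt_le_trans rs.
  have subc u : a <= u <= r -> a <= u <= s.
    by move=> /andP[-> ur]/=; exact: le_trans rs.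
  have arJ : `[a, r] `<=` J.
    by move=> u; rewrite /= in_itv/= => /subc us; apply: asJ; rewrite /= in_itv.
  have dlie u : a <= u <= r ->
      differentiable (lie (drift M) (h_par O b)) (xi u).
    move=> /subc us; rewrite h_parE.
    exact/differentiable_lie_drift/twice_derivable_reference/xiO.
  apply: (first_integral (F := closed_loop M O b) ar arJ cxi _ dlie)
    => u /sub ur; first exact: (oJ u ur).
  exact: (derive_closed_loop_lie (domr _ (widen _ ur)) (xiO _ (widen _ ur))).
have dh u : a <= u <= s -> differentiable (h_par O b) (xi u).
  move=> us; rewrite h_parE.
  have dref := twice_derivable_once (twice_derivable_reference b (xiO _ us)).
  exact: (@ex_diff _ _ _ _ _ _ _ (is_diff_constraint dref)).
(* the closed loop and the drift have the same configuration part *)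
have h0 : h_par O b (xi s) = 0.
  rewrite -hx0 -xia.
  apply: (first_integral (F := closed_loop M O b) as_ asJ cxi oJ dh) => u us.
  rewrite -(lie0 _ (widen _ us)) (lie_h_par b (xiO _ (widen _ us))) h_parE.
  apply: (derive_constraint (closed_loop_fst b (xi u))).
  exact/twice_derivable_once/twice_derivable_reference/xiO/widen.
have ss : a <= s <= s by rewrite as_ lexx.
by split; [exact: Txis|exact: h0|exact: (lie0 s ss)|exact: (xiO s ss)].
Qed.

Lemma closed_dom_thp b b' (x : state R) : theta x.1 = thp O ->
  closed_dom M O b x -> closed_dom M O b' x.
Proof.
move=> xO [Tx Du]; split; first exact: Tx.
by rewrite (decoupling_thp b' b xO).
Qed.

Variable Phi : flow M O.

(** The bound on [s] is not strict, so that the state at which the step ends is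
included: this is what carries the induction from one step to the next. *)
Lemma step_zero_dynamics b t0 (x : state R) s :
  surfZ M O (impact M x) -> theta (impact M x).1 = thp O ->
  closed_dom M O b (impact M x) -> theta_increases Phi b t0 x ->
  phi_dom Phi b t0 (impact M x) s -> (s%:E <= impact_time Phi t0 x b)%E ->
  surfZb M O b (phi Phi b t0 (impact M x) s).
Proof.
move=> Zx xO Dx [thO _] Js sT.
have [sol _] := phi_max Phi t0 Dx.
apply: (solution_zero_dynamics sol _ Js) => [|r rs].
  by apply: (surfZ_surfZb _).1 Zx => _; rewrite xO; exact: hs_flat_thp.
apply: thO; split; last by apply: le_trans sT; rewrite lee_fin; case/andP: rs.
by have [[iJ Jt0] _ _ _ _] := sol; exact: (iJ _ _ Jt0 Js).
Qed.

End Model.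

Theorem proposition2 (R : realType) (M : biped R) (m : nat) (O : outputs R m)
  (Phi : flow M O) (P : finType) (beta : P -> 'cV[R]_m)
  (beta_stable : forall p, exp_stable_limit_cycle Phi (beta p))
  (Z_impact_invariant : forall x, (surfS M `&` surfZ M O) x ->
     surfZ M O (impact M x) /\ theta (impact M x).1 = thp O)
  (impact_end : forall x, (surfS M `&` surfZ M O) x ->
     ths O <= theta x.1 <= thm O)
  (impact_end_par : forall p x, (surfS M `&` surfZb M O (beta p)) x ->
     ths O <= theta x.1 <= thm O)
  (sigma : nat -> P) (x : nat -> state R) (t : nat -> R)
  (x_switched : forall k,
     poincare Phi (beta (sigma k)) (t k) (x k) (x k.+1))
  (theta_monotone : forall k,
     theta_increases Phi (beta (sigma k)) (t k) (x k) /\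
     theta_increases Phi (beta (sigma k.+1)) (t k) (x k))
  (x0_SZ : (surfS M `&` surfZ M O) (x 0%N)) :
  forall k (s : R),
    t k <= s -> (s%:E < impact_time Phi (t k) (x k) (beta (sigma k.+1)))%E ->
    phi_dom Phi (beta (sigma k.+1)) (t k) (impact M (x k)) s ->
    surfZb M O (beta (sigma k.+1))
      (phi Phi (beta (sigma k.+1)) (t k) (impact M (x k)) s).
Proof.
have SZ k : (surfS M `&` surfZ M O) (x k).
  elim: k => [|k SZk]; first exact: x0_SZ.
  have [ZD thD] := Z_impact_invariant _ SZk.
  have [_ Dk Sk1 [T [TI JT xk1]]] := x_switched k.
  have Zb : surfZb M O (beta (sigma k)) (x k.+1).
    rewrite xk1; apply: (step_zero_dynamics ZD thD Dk _ JT); last by rewrite TI.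
    exact: (theta_monotone k).1.
  split; first exact: Sk1.
  have endk := impact_end_par (sigma k) (x k.+1) (conj Sk1 Zb).
  exact: (surfZ_surfZb M (fun=> hs_flat_end (beta (sigma k)) endk)).2 Zb.
move=> k s _ sT Js; have [ZD thD] := Z_impact_invariant _ (SZ k).
have [_ Dk _ _] := x_switched k.
exact: (step_zero_dynamics ZD thD (closed_dom_thp _ thD Dk)
  (theta_monotone k).2 Js (ltW sT)).
Qed.
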